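(* Suppose $|a|_p<\alpha<\beta$. Put $\check\alpha(x)=|f(x)|_p$ for $x\in S_\alpha(0)\setminus\{\hat x_1\}$, $\check\beta(x)=|f(x)|_p$ for $x\in S_\beta(0)\setminus\{\hat x_2\}$, and $\check a(x)=|f(x)|_p$ for $x\in S_{\alpha\beta/|a|_p}(0)$. Let $x\in S_r(0)\setminus\mathcal P$. Then the $p$-adic dynamical system generated by $f$ has the following properties. 1. $SI(x_1)=U_\alpha(0)$. 2. If $\alpha<r<\beta$, then $f(x)\in S_\alpha(0)$. 3. Let $r>\beta$. Then for every $n\ge1$: $f^n(x)\in S_{\alpha\beta/r}(0)$ if $\alpha<r<\alpha\beta/|a|_p$; $f^n(x)\in S_{\check a(x)}(0)$ if $r=\alpha\beta/|a|_p$; $f^n(x)\in S_{|a|_p}(0)$ if $r>\alpha\beta/|a|_p$. 4. Let $x\in S_\alpha(0)\setminus\mathcal P$. (4.1) If $\check\alpha(x)=\alpha$, then $f(x)\in S_\alpha(0)$. (4.2) If $\alpha<\check\alpha(x)<\beta$, then $f^2(x)\in S_\alpha(0)$. (4.3) If $\check\alpha(x)=\beta$, then $f(x)\in S_\beta(0)$. (4.4) If $\check\alpha(x)>\beta$, then for every $n\ge2$: $f^n(x)\in S_{\alpha\beta/\check\alpha(x)}(0)$ if $\alpha<\check\alpha(x)<\alpha\beta/|a|_p$; $f^n(x)\in S_{\check a(f(x))}(0)$ if $\check\alpha(x)=\alpha\beta/|a|_p$; $f^n(x)\in S_{|a|_p}(0)$ if $\check\alpha(x)>\alpha\beta/|a|_p$.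 5. Let $x\in S_\beta(0)\setminus\mathcal P$. (5.1) If $\check\beta(x)=\alpha$, then $f(x)\in S_\alpha(0)$. (5.2) If $\alpha<\check\beta(x)<\beta$, then $f^2(x)\in S_\alpha(0)$. (5.3) If $\check\beta(x)=\beta$, then $f(x)\in S_\beta(0)$. (5.4) If $\check\beta(x)>\beta$, then for every $n\ge2$: $f^n(x)\in S_{\alpha\beta/\check\beta(x)}(0)$ if $\alpha<\check\beta(x)<\alpha\beta/|a|_p$; $f^n(x)\in S_{\check a(f(x))}(0)$ if $\check\beta(x)=\alpha\beta/|a|_p$; $f^n(x)\in S_{|a|_p}(0)$ if $\check\beta(x)>\alpha\beta/|a|_p$. 6. (6.1) $x_2\in S_\beta(0)$. (6.2) The fixed point $x_2$ is a repeller and the inequality $|f(x)-x_2|_p>|x-x_2|_p$ holds for $x\in U_\beta(x_2)\setminus\mathcal P$, $x\neq x_2$.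
   Context: $p$ is a prime and $\mathbb C_p$ is the field of complex $p$-adic numbers with norm $|\cdot|_p$. Let $a,b,d\in\mathbb C_p$ with $ab\neq0$, $a\ne d$, and $$f(x)=\frac{ax^2+bx}{x^2+dx+b},\qquad x\in\mathbb C_p\setminus\{\hat x_1,\hat x_2\},$$ where $\hat x_1,\hat x_2\in\mathbb C_p$ are the two (possibly equal) roots of $x^2+dx+b$. Put $\alpha=|\hat x_1|_p$, $\beta=|\hat x_2|_p$, labelled so that $\alpha\le\beta$. Standing assumption: $f$ has the two distinct fixed points $x_1=0$ and $x_2=a-d$ (in particular $x_2\notin\{\hat x_1,\hat x_2\}$, i.e. $b+a(a-d)\neq0$). $\mathcal P=\{x\in\mathbb C_p:\exists n\in\mathbb N\cup\{0\},\ f^n(x)\in\{\hat x_1,\hat x_2\}\}$, where $f^n$ is the $n$-th iterate ($f^0=\mathrm{id}$). For $c\in\mathbb C_p$, $r\geq 0$: $U_r(c)=\{x:|x-c|_p<r\}$, $V_r(c)=\{x:|x-c|_p\le r\}$, $S_r(c)=\{x:|x-c|_p=r\}$ (so $S_0(0)=\{0\}$). A fixed point $x_0$ is attractive, indifferent, repeller if $|f'(x_0)|_p<1$, $=1$, $>1$ respectively. A sphere $S$ is invariant if $f$ is defined on $S$ and $f(S)\subset S$. An open ball $U_r(x_0)$ about a fixed point $x_0$ is a Siegel disk if every sphere $S_\rho(x_0)$, $0<\rho<r$, is invariant; $SI(x_0)$ is the union of all Siegel disks centred at $x_0$ (the maximal Siegel disk). *)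

(* Defs.v *)
From HB Require Import structures.
From mathcomp Require Import all_boot all_order all_algebra.
From mathcomp Require Import boolp classical_sets reals.

Set Implicit Arguments.
Unset Strict Implicit.
Unset Printing Implicit Defensive.

Import Order.TTheory GRing.Theory Num.Theory.
Local Open Scope classical_set_scope.
Local Open Scope ring_scope.

Section PadicComplexNumbers.
Variables (R : realType) (p : nat).

Definition padic_norm (q : rat) : R :=
  if q == 0 then 0
  else p%:R ^+ logn p `|denq q|%N / p%:R ^+ logn p `|numq q|%N.

Variables (K : fieldType) (nrm : K -> R).

Definition cauchy_seq (u : nat -> K) : Prop :=
  forall e : R, 0 < e -> exists N : nat, forall m n : nat,
    (N <= m)%N -> (N <= n)%N -> nrm (u m - u n) < e.

Definition cvg_seq (u : nat -> K) (l : K) : Prop :=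
  forall e : R, 0 < e -> exists N : nat, forall n : nat,
    (N <= n)%N -> nrm (u n - l) < e.

(* The topological closure of the prime field in K.  If K is complete and nrm
   extends the p-adic norm of the rationals, this is the completion Q_p. *)
Definition Qp : set K :=
  [set x | forall e : R, 0 < e -> exists q : rat, nrm (x - ratr q) < e].

Definition Qp_algebraic : set K :=
  [set x | exists P : {poly K},
     [/\ P != 0, forall i : nat, Qp P`_i & root P x]].

(* (K, nrm) is the field C_p, the completion of an algebraic closure of Q_p:
   nrm is a complete ultrametric absolute value extending the p-adic norm of
   the rationals (so that K contains Q_p), the elements algebraic over Q_p form
   an algebraically closed field, and that field is dense in K.  These
   properties determine (K, nrm) up to isometric isomorphism. *)
Record is_padic_complex : Prop := IsPadicComplex {
  nrm_ge0 : forall x, 0 <= nrm x;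
  nrm_eq0 : forall x, nrm x = 0 -> x = 0;
  nrmM : forall x y, nrm (x * y) = nrm x * nrm y;
  nrm_ultra : forall x y, nrm (x + y) <= Num.max (nrm x) (nrm y);
  nrm_rat : forall q : rat, nrm (ratr q) = padic_norm q;
  nrm_complete : forall u, cauchy_seq u -> exists l, cvg_seq u l;
  Qp_algebraic_closed : forall P : {poly K}, (1 < size P)%N ->
    (forall i : nat, Qp_algebraic P`_i) ->
    exists2 x, Qp_algebraic x & root P x;
  Qp_algebraic_dense : forall (x : K) (e : R), 0 < e ->
    exists2 y, Qp_algebraic y & nrm (x - y) < e
}.

End PadicComplexNumbers.

Section Dynamics.
Variables (R : realType) (K : fieldType) (nrm : K -> R).

Definition Uball (r : R) (c : K) : set K := [set x | nrm (x - c) < r].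
Definition Sphere (r : R) (c : K) : set K := [set x | nrm (x - c) = r].

(* A partial map K -> K is represented by a total function f together with the
   set Z of points where it is not defined; f is arbitrary on Z. *)
Variables (Z : set K) (f : K -> K).

(* The values of f on Z do not matter here: the first n with f^n(x) in Z is
   reached through points where the partial map is defined. *)
Definition singular_orbits : set K := [set x | exists n : nat, Z (iter n f x)].

Definition is_fixed_point (x0 : K) : Prop := ~ Z x0 /\ f x0 = x0.

Definition has_derivative (x0 l : K) : Prop :=
  forall e : R, 0 < e -> exists2 delta : R, 0 < delta &
    forall h : K, h != 0 -> nrm h < delta ->
      ~ Z (x0 + h) /\ nrm ((f (x0 + h) - f x0) / h - l) < e.

Definition is_repeller (x0 : K) : Prop :=
  is_fixed_point x0 /\ exists2 l, has_derivative x0 l & 1 < nrm l.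

Definition invariant_set (S : set K) : Prop :=
  forall x, S x -> ~ Z x /\ S (f x).

Definition is_siegel_disk (x0 : K) (r : R) : Prop :=
  [/\ is_fixed_point x0, 0 < r &
      forall rho : R, 0 < rho -> rho < r -> invariant_set (Sphere rho x0)].

Definition SI (x0 : K) : set K :=
  \bigcup_(r in is_siegel_disk x0) Uball r x0.

End Dynamics.

Section TheMap.
Variables (K : fieldType) (a b d : K).

Definition fmap (x : K) : K := (a * x ^+ 2 + b * x) / (x ^+ 2 + d * x + b).

End TheMap.

(* Main.v *)
From HB Require Import structures.
From mathcomp Require Import all_boot all_order all_algebra.
From mathcomp Require Import boolp classical_sets filter reals.
From mathcomp Require Import ring.
(* Imported last: filter.v also exports a [fmap]. *)
Require Import Defs.

(** Writing [f x = x (a x + b) / ((x - xh1) (x - xh2))], the ultrametric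
    inequality makes each factor have the norm of its dominant term, so that
    [|f x|] is a function of [|x|] alone off the critical spheres of radii
    [alpha], [beta] and [alpha beta / |a|].  Everything outside the closed ball
    of radius [beta] is sent into the open ball of radius [alpha], where [f]
    preserves the norm.  Near [x2 = a - d] the identity
    [f x - x2 = (x - x2) (d x + b) / ((x - xh1) (x - xh2))] gives expansion:
    the numerator has norm [beta ^ 2], while [|x - xh2| < beta] because
    [x2 - xh2 = a + xh1].  By continuity, the second factor at [x2] is also the
    derivative there. *)

Set Implicit Arguments.
Unset Strict Implicit.
Unset Printing Implicit Defensive.

Import Order.TTheory GRing.Theory Num.Theory.
Local Open Scope classical_set_scope.
Local Open Scope ring_scope.

Record ultrametric_abs (R : realFieldType) (K : fieldType) := UltrametricAbs {
  uabs :> K -> R;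
  uabs_ge0 : forall x, 0 <= uabs x;
  uabs_eq0 : forall x, (uabs x == 0) = (x == 0);
  uabsM : forall x y, uabs (x * y) = uabs x * uabs y;
  uabsD : forall x y, uabs (x + y) <= Num.max (uabs x) (uabs y)
}.

Section UltrametricAbsTheory.
Variables (R : realFieldType) (K : fieldType) (nrm : ultrametric_abs R K).
Implicit Types (x y : K) (r : R).

Lemma uabs0 : nrm 0 = 0.
Proof. by apply/eqP; rewrite uabs_eq0. Qed.

Lemma uabs_gt0 x : (0 < nrm x) = (x != 0).
Proof. by rewrite lt_def uabs_ge0 andbT uabs_eq0. Qed.

Lemma uabsN x : nrm (- x) = nrm x.
Proof.
by apply/eqP; rewrite -(@eqrXn2 _ 2) ?uabs_ge0// !expr2 -!uabsM mulrNN.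
Qed.

Lemma uabs_div x y : nrm (x / y) = nrm x / nrm y.
Proof.
have [->|y_neq0] := eqVneq y 0; first by rewrite invr0 mulr0 uabs0 invr0 mulr0.
have nrmy_neq0 : nrm y != 0 by rewrite uabs_eq0.
by apply: (mulIf nrmy_neq0); rewrite -uabsM !divfK.
Qed.

Lemma uabsD_le x y r : nrm x <= r -> nrm y <= r -> nrm (x + y) <= r.
Proof. by move=> xr yr; rewrite (le_trans (uabsD nrm x y))// ge_max xr. Qed.

Lemma uabsD_lt x y r : nrm x < r -> nrm y < r -> nrm (x + y) < r.
Proof. by move=> xr yr; rewrite (le_lt_trans (uabsD nrm x y))// gt_max xr. Qed.

Lemma uabsDl x y : nrm y < nrm x -> nrm (x + y) = nrm x.
Proof.
move=> yx; apply/eqP; rewrite eq_le uabsD_le ?(ltW yx)//= leNgt.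
apply/negP => xy_lt.
have : nrm ((x + y) - y) < nrm x by apply: uabsD_lt; rewrite ?uabsN.
by rewrite addrK ltxx.
Qed.

Lemma uabsDr x y : nrm x < nrm y -> nrm (x + y) = nrm y.
Proof. by rewrite addrC; apply: uabsDl. Qed.

Lemma uabsBl x y : nrm y < nrm x -> nrm (x - y) = nrm x.
Proof. by move=> yx; rewrite uabsDl ?uabsN. Qed.

Lemma uabsBr x y : nrm x < nrm y -> nrm (x - y) = nrm y.
Proof. by move=> xy; rewrite uabsDr ?uabsN. Qed.

Lemma uabs_near_eq x y : nrm (x - y) < nrm y -> nrm x = nrm y.
Proof. by move=> xy; rewrite -(subrK y x) uabsDr. Qed.

End UltrametricAbsTheory.

Lemma padic_complex_eq0 (R : realType) (p : nat) (K : fieldType) (nrm : K -> R)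
  (Kp : is_padic_complex p nrm) (x : K) : (nrm x == 0) = (x == 0).
Proof.
apply/eqP/eqP => [/(nrm_eq0 Kp)//|->].
have -> : (0 : K) = ratr 0 by exact: esym (ratr_nat K 0).
by rewrite (nrm_rat Kp) /padic_norm eqxx.
Qed.

Definition padic_complex_uabs (R : realType) (p : nat) (K : fieldType)
    (nrm : K -> R) (Kp : is_padic_complex p nrm) : ultrametric_abs R K :=
  UltrametricAbs (nrm_ge0 Kp) (padic_complex_eq0 Kp) (nrmM Kp) (nrm_ultra Kp).

Section Continuity.
Variables (R : realType) (K : fieldType) (nrm : ultrametric_abs R K).
Implicit Types (g h : K -> K) (Z : set K) (x : K).

Definition uball_nbhs x : set_system K :=
  filter_from [set r : R | 0 < r] (fun r => Uball nrm r x).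

Global Instance uball_nbhs_filter x : Filter (uball_nbhs x).
Proof.
apply: filter_from_filter; first by exists 1 => /=.
move=> r s r_gt0 s_gt0; exists (Num.min r s); first by rewrite /= lt_min r_gt0.
by move=> y; rewrite /Uball /= lt_min => /andP[].
Qed.

Definition continuous_at g x :=
  forall e : R, 0 < e -> \forall y \near uball_nbhs x, nrm (g y - g x) < e.

Lemma continuous_at_cst (k : K) x : continuous_at (fun=> k) x.
Proof. by move=> e e_gt0; apply: filterE => y; rewrite subrr uabs0. Qed.

Lemma continuous_at_id x : continuous_at id x.
Proof. by move=> e e_gt0; exists e. Qed.

Lemma continuous_atD g h x :
  continuous_at g x -> continuous_at h x ->
  continuous_at (fun y => g y + h y) x.
Proof.
move=> g_cont h_cont e e_gt0.
apply: filterS2 (g_cont e e_gt0) (h_cont e e_gt0) => y g_e h_e.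
by rewrite opprD addrACA uabsD_lt.
Qed.

Lemma continuous_atM g h x :
  continuous_at g x -> continuous_at h x ->
  continuous_at (fun y => g y * h y) x.
Proof.
move=> g_cont h_cont e e_gt0.
pose M := Num.max 1 (Num.max (nrm (g x)) (nrm (h x))).
have M_gt0 : 0 < M by rewrite lt_max ltr01.
have gM : nrm (g x) <= M by rewrite !le_max lexx orbT.
have hM : nrm (h x) <= M by rewrite !le_max lexx !orbT.
have eM_gt0 : 0 < e / M by rewrite divr_gt0.
apply: filterS3 (g_cont _ eM_gt0) (h_cont _ eM_gt0) (h_cont _ ltr01).
move=> y; rewrite !ltr_pdivlMr// => g_e h_e h_1.
have hyM : nrm (h y) <= M.
  by rewrite -(subrK (h x) (h y)) uabsD_le// (le_trans (ltW h_1))// le_max lexx.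
have -> : g y * h y - g x * h x = (g y - g x) * h y + (h y - h x) * g x by ring.
apply: uabsD_lt; rewrite uabsM.
  by apply: le_lt_trans g_e; rewrite ler_wpM2l ?uabs_ge0.
by apply: le_lt_trans h_e; rewrite ler_wpM2l ?uabs_ge0.
Qed.

Lemma continuous_at_neq0 g x :
  continuous_at g x -> g x != 0 -> \forall y \near uball_nbhs x, g y != 0.
Proof.
rewrite -(uabs_gt0 nrm) => g_cont gx_gt0.
apply: filterS (g_cont _ gx_gt0) => y /uabs_near_eq gyx.
by rewrite -(uabs_gt0 nrm) gyx.
Qed.

Lemma continuous_atV g x :
  continuous_at g x -> g x != 0 -> continuous_at (fun y => (g y)^-1) x.
Proof.
move=> g_cont gx_neq0 e e_gt0.
have gx_gt0 : 0 < nrm (g x) by rewrite uabs_gt0.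
have e_scaled_gt0 : 0 < e * (nrm (g x) * nrm (g x)) by rewrite !mulr_gt0.
have := g_cont _ e_scaled_gt0; have := g_cont _ gx_gt0.
apply: filterS3 (continuous_at_neq0 g_cont gx_neq0).
move=> y gy_neq0 /uabs_near_eq gyx g_e.
have -> : (g y)^-1 - (g x)^-1 = - ((g y - g x) / (g y * g x)).
  by field; apply/andP.
by rewrite uabsN uabs_div uabsM gyx ltr_pdivrMr ?mulr_gt0.
Qed.

Lemma caratheodory_has_derivative Z (f phi : K -> K) x :
  (\forall y \near uball_nbhs x, ~ Z y) -> continuous_at phi x ->
  (forall y, ~ Z y -> f y - f x = (y - x) * phi y) ->
  has_derivative nrm Z f x (phi x).
Proof.
move=> nearNZ phi_cont f_slope e e_gt0.
have [r r_gt0 rP] := filterI nearNZ (phi_cont e e_gt0).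
exists r => // h h_neq0 h_lt_r.
have [|NZ phi_e] := rP (x + h); first by rewrite /Uball /= addrAC subrr add0r.
by split=> //; rewrite f_slope// addrAC subrr add0r mulrAC divff// mul1r.
Qed.

End Continuity.

Lemma deg2_monic_vieta (K : comNzRingType) (b d u v : K) :
  'X^2 + d *: 'X + b%:P = ('X - u%:P) * ('X - v%:P) ->
  d = - (u + v) /\ b = u * v.
Proof.
move=> factored; have bE : b = u * v.
  have := congr1 (horner^~ 0) factored.
  by rewrite !hornerE /= expr0n /= add0r mulrNN.
split=> //; have := congr1 (horner^~ 1) factored; rewrite !hornerE /= bE => at1.
have -> : d = (1 ^+ 2 + d + u * v) - (1 + u * v) by ring.
by rewrite at1; ring.
Qed.

Lemma Sphere0E (R : realType) (K : fieldType) (nrm : K -> R) (r : R) (x : K) :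
  Sphere nrm r 0 x = (nrm x = r).
Proof. by rewrite /Sphere /= subr0. Qed.

Section QuadraticRationalMap.
Variables (R : realType) (K : fieldType) (nrm : ultrametric_abs R K).
Variables a b d xh1 xh2 : K.

Local Notation f := (fmap a b d).
Local Notation Z := [set xh1; xh2].
Local Notation alpha := (nrm xh1).
Local Notation beta := (nrm xh2).
Local Notation A := (nrm a).
Local Notation x2 := (a - d).
Local Notation denom x := ((x - xh1) * (x - xh2)).

Hypothesis roots : 'X^2 + d *: 'X + b%:P = ('X - xh1%:P) * ('X - xh2%:P).

Let bE : b = xh1 * xh2. Proof. by case: (deg2_monic_vieta roots). Qed.
Let dE : d = - (xh1 + xh2). Proof. by case: (deg2_monic_vieta roots). Qed.

Lemma fmap_factored x : f x = x * (a * x + b) / denom x.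
Proof. by rewrite /fmap; congr (_ / _); rewrite ?bE ?dE; ring. Qed.

Lemma denom_neq0P x : reflect (~ Z x) (denom x != 0).
Proof.
rewrite mulf_eq0 !subr_eq0; apply: (iffP negP) => nZ xZ; apply: nZ.
  by case: xZ => ->; rewrite eqxx ?orbT.
by case/orP: xZ => /eqP ->; [left | right].
Qed.

Hypotheses (a_neq0 : a != 0) (A_lt_alpha : A < alpha).
Hypothesis alpha_lt_beta : alpha < beta.

Local Notation critical_radius := (alpha * beta / A).

Let A_gt0 : 0 < A. Proof. by rewrite uabs_gt0. Qed.
Let alpha_gt0 : 0 < alpha. Proof. exact: lt_trans A_lt_alpha. Qed.
Let beta_gt0 : 0 < beta. Proof. exact: lt_trans alpha_lt_beta. Qed.
Let A_lt_beta : A < beta. Proof. exact: lt_trans alpha_lt_beta. Qed.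

Let uabs_b : nrm b = alpha * beta. Proof. by rewrite bE uabsM. Qed.
Let uabs_d : nrm d = beta. Proof. by rewrite dE uabsN uabsDr. Qed.

Let beta_lt_critical_radius : beta < critical_radius.
Proof. by rewrite ltr_pdivlMr // mulrC ltr_pM2r. Qed.

Lemma uabs_fmap x :
  nrm (f x) = nrm x * nrm (a * x + b) / (nrm (x - xh1) * nrm (x - xh2)).
Proof. by rewrite fmap_factored uabs_div !uabsM. Qed.

Lemma uabs_numer x : nrm x < critical_radius -> nrm (a * x + b) = alpha * beta.
Proof.
by move=> xr; rewrite uabsDr uabs_b// uabsM mulrC -ltr_pdivlMr.
Qed.

Lemma uabs_fmap_inner x : nrm x < alpha -> nrm (f x) = nrm x.
Proof.
move=> x_alpha; have x_beta := lt_trans x_alpha alpha_lt_beta.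
rewrite uabs_fmap uabs_numer ?(lt_trans x_beta)// !uabsBr//.
by rewrite mulfK// mulf_neq0 ?gt_eqF.
Qed.

Lemma uabs_fmap_annulus x : alpha < nrm x -> nrm x < beta -> nrm (f x) = alpha.
Proof.
move=> x_alpha x_beta; have x_gt0 := lt_trans alpha_gt0 x_alpha.
rewrite uabs_fmap uabs_numer ?(lt_trans x_beta)// uabsBl// uabsBr//.
by rewrite mulrCA mulfK// mulf_neq0 ?gt_eqF.
Qed.

Lemma uabs_fmap_outer x : beta < nrm x -> nrm (f x) = nrm (a * x + b) / nrm x.
Proof.
move=> x_beta; have x_gt0 := lt_trans beta_gt0 x_beta.
rewrite uabs_fmap !uabsBl// ?(lt_trans alpha_lt_beta)//.
by rewrite -mulf_div divff ?gt_eqF// mul1r.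
Qed.

Lemma uabs_fmap_lt_critical x : beta < nrm x -> nrm x < critical_radius ->
  nrm (f x) = alpha * beta / nrm x.
Proof. by move=> x_beta xr; rewrite uabs_fmap_outer// uabs_numer. Qed.

Lemma uabs_fmap_gt_critical x : critical_radius < nrm x -> nrm (f x) = A.
Proof.
move=> xr; have x_beta := lt_trans beta_lt_critical_radius xr.
have x_gt0 := lt_trans beta_gt0 x_beta.
rewrite uabs_fmap_outer// uabsDl uabsM; first by rewrite mulfK ?gt_eqF.
by rewrite uabs_b -ltr_pdivrMl // mulrC.
Qed.

Lemma uabs_fmap_critical x : nrm x = critical_radius -> nrm (f x) <= A.
Proof.
move=> xr; have x_beta : beta < nrm x by rewrite xr.
have x_gt0 := lt_trans beta_gt0 x_beta.
rewrite uabs_fmap_outer// ler_pdivrMr// uabsD_le ?uabsM//.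
by rewrite uabs_b xr mulrCA divff ?gt_eqF// mulr1.
Qed.

Lemma uabs_fmap_outer_lt_alpha x : beta < nrm x -> nrm (f x) < alpha.
Proof.
move=> x_beta; have x_gt0 := lt_trans beta_gt0 x_beta.
have [xr|xr|xr] := ltgtP (nrm x) critical_radius.
- by rewrite uabs_fmap_lt_critical// ltr_pdivrMr// ltr_pM2l.
- by rewrite uabs_fmap_gt_critical.
- exact: le_lt_trans (uabs_fmap_critical xr) A_lt_alpha.
Qed.

Lemma uabs_iter_inner n x : nrm x < alpha -> nrm (iter n f x) = nrm x.
Proof.
by move=> x_alpha; elim: n => //= n IHn; rewrite uabs_fmap_inner ?IHn.
Qed.

Lemma uabs_iter_outer n x : beta < nrm x -> (1 <= n)%N ->
  nrm (iter n f x) = nrm (f x).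
Proof.
case: n => // n x_beta _.
by rewrite iterSr uabs_iter_inner// uabs_fmap_outer_lt_alpha.
Qed.

Definition on_outer_image_sphere (x y : K) : Prop :=
  [/\ alpha < nrm x -> nrm x < critical_radius ->
        Sphere nrm (alpha * beta / nrm x) 0 y,
      nrm x = critical_radius -> Sphere nrm (nrm (f x)) 0 y
    & critical_radius < nrm x -> Sphere nrm A 0 y].

Lemma iter_on_outer_image_sphere n x : beta < nrm x -> (1 <= n)%N ->
  on_outer_image_sphere x (iter n f x).
Proof.
move=> x_beta n_ge1; split; rewrite Sphere0E uabs_iter_outer//.
  by move=> _; exact: uabs_fmap_lt_critical.
exact: uabs_fmap_gt_critical.
Qed.

Lemma fmap_itinerary x :
  [/\ nrm (f x) = alpha -> Sphere nrm alpha 0 (f x),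
      alpha < nrm (f x) -> nrm (f x) < beta -> Sphere nrm alpha 0 (iter 2 f x),
      nrm (f x) = beta -> Sphere nrm beta 0 (f x)
    & beta < nrm (f x) -> forall n : nat, (2 <= n)%N ->
      on_outer_image_sphere (f x) (iter n f x)].
Proof.
split; rewrite ?Sphere0E//; first exact: uabs_fmap_annulus.
move=> fx_beta [//|n] n_ge2; rewrite iterSr.
exact: iter_on_outer_image_sphere.
Qed.

Lemma fmap_siegel_disk0 : is_siegel_disk nrm Z f 0 alpha.
Proof.
have not_pole x : nrm x < alpha -> ~ Z x.
  move=> x_alpha; have x_beta := lt_trans x_alpha alpha_lt_beta.
  by case=> xE; [move: x_alpha | move: x_beta]; rewrite xE ltxx.
split=> //.
  by split; [apply: not_pole; rewrite uabs0 | rewrite fmap_factored !mul0r].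
move=> rho _ rho_alpha x; rewrite !Sphere0E => xr.
have x_alpha : nrm x < alpha by rewrite xr.
by split; [exact: not_pole | rewrite uabs_fmap_inner].
Qed.

Lemma fmap_SI0 : SI nrm Z f 0 = Uball nrm alpha 0.
Proof.
apply/seteqP; split=> x; last by exists alpha => //; exact: fmap_siegel_disk0.
case=> r [_ _ invariant_spheres] xr; apply: (lt_le_trans xr); rewrite leNgt.
apply/negP => /(invariant_spheres _ alpha_gt0) /(_ xh1).
by rewrite Sphere0E => -[//|]; case; left.
Qed.

Lemma uabs_x2 : nrm x2 = beta.
Proof. by rewrite uabsBr uabs_d. Qed.

Lemma uabs_near_x2 x : nrm (x - x2) < beta -> nrm x = beta.
Proof. by rewrite -uabs_x2; exact: uabs_near_eq. Qed.

Definition x2_slope (x : K) : K := (d * x + b) / denom x.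

Lemma fmap_sub_x2 x : ~ Z x -> f x - x2 = (x - x2) * x2_slope x.
Proof.
move=> /denom_neq0P; rewrite mulf_eq0 negb_or => /andP[? ?].
by rewrite fmap_factored /x2_slope bE dE; field; apply/andP.
Qed.

Lemma uabs_slope_numer x : nrm (x - x2) < beta -> nrm (d * x + b) = beta ^+ 2.
Proof.
move=> x_near; have x_beta := uabs_near_x2 x_near.
have dx : nrm (d * x) = beta ^+ 2 by rewrite uabsM uabs_d x_beta expr2.
by rewrite uabsDl dx// uabs_b expr2 ltr_pM2r.
Qed.

Lemma uabs_denom_near_x2 x : nrm (x - x2) < beta -> nrm (denom x) < beta ^+ 2.
Proof.
move=> x_near; have x_beta := uabs_near_x2 x_near.
rewrite uabsM uabsBl x_beta// expr2 ltr_pM2l//.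
have -> : x - xh2 = (x - x2) + (a + xh1) by rewrite dE; ring.
by do 2![apply: uabsD_lt => //].
Qed.

Lemma x2_slope_expands x : nrm (x - x2) < beta -> ~ Z x -> 1 < nrm (x2_slope x).
Proof.
move=> x_near /denom_neq0P denom_neq0.
rewrite uabs_div uabs_slope_numer// ltr_pdivlMr ?uabs_gt0// mul1r.
exact: uabs_denom_near_x2.
Qed.

Lemma fmap_expands_near_x2 x : nrm (x - x2) < beta -> ~ Z x -> x != x2 ->
  nrm (x - x2) < nrm (f x - x2).
Proof.
move=> x_near xNZ x_neq; rewrite fmap_sub_x2// uabsM.
by rewrite ltr_pMr ?x2_slope_expands// uabs_gt0 subr_eq0.
Qed.

Hypothesis x2_regular : b + a * (a - d) != 0.

Let x2_not_pole : ~ Z x2.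
Proof.
apply/denom_neq0P; have -> // : denom x2 = b + a * (a - d).
by rewrite bE dE; ring.
Qed.

Lemma fmap_fixed_x2 : f x2 = x2.
Proof. by apply/eqP; rewrite -subr_eq0 fmap_sub_x2// subrr mul0r. Qed.

Lemma fmap_derivative_x2 : has_derivative nrm Z f x2 (x2_slope x2).
Proof.
have id_cont := continuous_at_id nrm x2.
have cst_cont k := continuous_at_cst nrm k x2.
have numer_cont : continuous_at nrm (fun x => d * x + b) x2.
  by apply: continuous_atD => //; apply: continuous_atM.
have sub_cont u : continuous_at nrm (fun x => x - u) x2.
  exact: continuous_atD.
have denom_cont : continuous_at nrm (fun x => denom x) x2.
  exact: continuous_atM.
have denom_x2_neq0 : denom x2 != 0 by apply/denom_neq0P.
apply: caratheodory_has_derivative.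
- apply: filterS (continuous_at_neq0 denom_cont denom_x2_neq0) => y.
  by move/denom_neq0P.
- by apply: continuous_atM => //; apply: continuous_atV.
- by move=> y yNZ; rewrite fmap_fixed_x2 fmap_sub_x2.
Qed.

Lemma fmap_repeller_x2 : is_repeller nrm Z f x2.
Proof.
split; first by split=> //; exact: fmap_fixed_x2.
exists (x2_slope x2); first exact: fmap_derivative_x2.
by apply: x2_slope_expands => //; rewrite subrr uabs0.
Qed.

End QuadraticRationalMap.

Theorem theorem5 (R : realType) (p : nat) (p_prime : prime p)
    (Cp : fieldType) (nrm : Cp -> R) (Cp_def : is_padic_complex p nrm)
    (a b d xh1 xh2 : Cp) (ab_neq0 : a * b != 0) (a_neq_d : a != d)
    (roots : 'X^2 + d *: 'X + b%:P = ('X - xh1%:P) * ('X - xh2%:P))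
    (x2_regular : b + a * (a - d) != 0) :
  let f := fmap a b d in
  let Z := [set xh1; xh2] in
  let P := singular_orbits Z f in
  let S := fun r : R => Sphere nrm r 0 in
  let alpha := nrm xh1 in
  let beta := nrm xh2 in
  let A := nrm a in
  let x2 := a - d in
  A < alpha -> alpha < beta ->
  (* 1 *)
  SI nrm Z f 0 = Uball nrm alpha 0 /\
  (* 2 *)
  (forall (r : R) (x : Cp), (S r `\` P) x ->
     alpha < r -> r < beta -> S alpha (f x)) /\
  (* 3 *)
  (forall (r : R) (x : Cp), (S r `\` P) x -> beta < r ->
     forall n : nat, (1 <= n)%N ->
     [/\ alpha < r -> r < alpha * beta / A ->
           S (alpha * beta / r) (iter n f x),
         r = alpha * beta / A -> S (nrm (f x)) (iter n f x)
       & alpha * beta / A < r -> S A (iter n f x)]) /\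
  (* 4 *)
  (forall x : Cp, (S alpha `\` P) x ->
     [/\ nrm (f x) = alpha -> S alpha (f x),
         alpha < nrm (f x) -> nrm (f x) < beta -> S alpha (iter 2 f x),
         nrm (f x) = beta -> S beta (f x)
       & beta < nrm (f x) -> forall n : nat, (2 <= n)%N ->
         [/\ alpha < nrm (f x) -> nrm (f x) < alpha * beta / A ->
               S (alpha * beta / nrm (f x)) (iter n f x),
             nrm (f x) = alpha * beta / A -> S (nrm (f (f x))) (iter n f x)
           & alpha * beta / A < nrm (f x) -> S A (iter n f x)]]) /\
  (* 5 *)
  (forall x : Cp, (S beta `\` P) x ->
     [/\ nrm (f x) = alpha -> S alpha (f x),
         alpha < nrm (f x) -> nrm (f x) < beta -> S alpha (iter 2 f x),
         nrm (f x) = beta -> S beta (f x)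
       & beta < nrm (f x) -> forall n : nat, (2 <= n)%N ->
         [/\ alpha < nrm (f x) -> nrm (f x) < alpha * beta / A ->
               S (alpha * beta / nrm (f x)) (iter n f x),
             nrm (f x) = alpha * beta / A -> S (nrm (f (f x))) (iter n f x)
           & alpha * beta / A < nrm (f x) -> S A (iter n f x)]]) /\
  (* 6 *)
  S beta x2 /\
  is_repeller nrm Z f x2 /\
  (forall x : Cp, (Uball nrm beta x2 `\` P) x -> x != x2 ->
     nrm (x - x2) < nrm (f x - x2)).
Proof.
move=> f Z P S alpha beta A x2 A_lt_alpha alpha_lt_beta.
pose v := padic_complex_uabs Cp_def.
have SE r x : S r x = (nrm x = r) := Sphere0E nrm r x.
have a_neq0 : a != 0 by move: ab_neq0; rewrite mulf_eq0 negb_or => /andP[].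
split; first exact: (fmap_SI0 (nrm := v) roots).
split.
  move=> r x [+ _]; rewrite !SE => <-.
  exact: (uabs_fmap_annulus (nrm := v) roots).
split.
  move=> r x [+ _]; rewrite SE => <- r_beta n n_ge1.
  exact: (iter_on_outer_image_sphere (nrm := v) roots).
split; first by move=> x _; exact: (fmap_itinerary (nrm := v) roots).
split; first by move=> x _; exact: (fmap_itinerary (nrm := v) roots).
split; first by rewrite SE; exact: (uabs_x2 (nrm := v) roots).
split; first exact: (fmap_repeller_x2 (nrm := v) roots).
move=> x [x_near xNP] x_neq.
apply: (fmap_expands_near_x2 (nrm := v) roots) => // Zx.
by apply: xNP; exists 0.
Qed.
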